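(* Let $N\ge 2$, let $\Omega,\Omega'\subset\mathbb{R}^N$ be open and bounded sets with $\Omega'\subset\Omega$, and let $f\in C^\alpha(\overline\Omega)$ for some $\alpha>0$. Then $$[L_\Delta E_{\Omega'}f-L_\Delta E_\Omega f](x)=c_N\int_{\Omega\setminus\Omega'}\frac{f(y)}{|x-y|^N}\,dy\qquad\text{for }x\in\Omega',$$ where $f$ is identified with its restriction to $\Omega'$. In particular, if $f\ge0$ in $\Omega$ and $L_\Delta E_\Omega f\ge 0$ in $\Omega$, then also $L_\Delta E_{\Omega'}f\ge 0$ in $\Omega'$.
   Context: For an open set $U$ and a function $g$ on $U$, $E_U g$ denotes the trivial extension of $g$ by $0$ to $\mathbb{R}^N$. The logarithmic Laplacian $L_\Delta$ is given, for $\phi$ Dini continuous at $x$ with $\int_{\mathbb{R}^N}(1+|z|)^{-N}|\phi(z)|dz<\infty$, by $$L_\Delta\phi(x)=c_N\,\mathrm{P.V.}\int_{B_1(0)}\frac{\phi(x)-\phi(x+y)}{|y|^N}dy-c_N\int_{\mathbb{R}^N\setminus B_1(0)}\frac{\phi(x+y)}{|y|^N}dy+\rho_N\phi(x),$$ with $c_N=\frac{\Gamma(N/2)}{\pi^{N/2}}$, $\rho_N=2\ln 2+\psi(\frac N2)-\gamma$, $\psi=\Gamma'/\Gamma$ and $\gamma=-\Gamma'(1)$. *)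

(* Defs.v *)
From HB Require Import structures.
From mathcomp Require Import all_boot all_order all_algebra.
From mathcomp Require Import all_classical all_reals all_analysis.

Set Implicit Arguments.
Unset Strict Implicit.
Unset Printing Implicit Defensive.

Import Order.TTheory GRing.Theory Num.Theory.
Import numFieldNormedType.Exports.

Local Open Scope classical_set_scope.
Local Open Scope ring_scope.

(* The measurable sets of R^n = 'rV[R]_n are those generated by the
   coordinates, i.e. the Borel sets. *)
Definition rV_display : measure_display. Proof. exact: default_measure_display. Qed.

Section measurable_rV.
Context {R : realType} {n : nat}.

Definition rV_coord (i : 'I_n) (v : 'rV[R]_n) : measurableTypeR R := v 0 i.

Let rV_measurable : set (set 'rV[R]_n) := g_sigma_preimage rV_coord.

Let rV_set0 : rV_measurable set0.
Proof. exact: sigma_algebra0. Qed.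

Let rV_setC A : rV_measurable A -> rV_measurable (~` A).
Proof. exact: sigma_algebraC. Qed.

Let rV_bigcup (F : (set 'rV[R]_n)^nat) :
  (forall i, rV_measurable (F i)) -> rV_measurable (\bigcup_i (F i)).
Proof. exact: sigma_algebra_bigcup. Qed.

HB.instance Definition _ := @isMeasurable.Build rV_display 'rV[R]_n
  rV_measurable rV_set0 rV_setC rV_bigcup.

End measurable_rV.

Lemma measurable_rV_coord (R : realType) (n : nat) (i : 'I_n) :
  measurable_fun [set: 'rV[R]_n] (rV_coord i).
Proof.
move=> _ Y mY; rewrite setTI; apply: sub_sigma_algebra => /=.
rewrite -bigcup_seq/=; exists i => /=; first by rewrite mem_index_enum.
by exists Y => //; rewrite setTI.
Qed.

Lemma measurable_fun_rVP (R : realType) d (T : measurableType d) (n : nat)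
    (f : T -> 'rV[R]_n) :
  (forall i, measurable_fun [set: T] (rV_coord i \o f)) ->
  measurable_fun [set: T] f.
Proof.
move=> mf _ A mA; rewrite setTI.
suff : g_sigma_preimage (@rV_coord R n) `<=` [set B | measurable (f @^-1` B)].
  exact.
apply: smallest_sub.
  split => /=.
  - by rewrite preimage_set0.
  - by move=> B mB; rewrite setTD preimage_setC; exact: measurableC.
  - by move=> F mF; rewrite preimage_bigcup; exact: bigcup_measurable.
move=> B; rewrite -bigcup_seq => -[i _ [C mC <-]] /=.
rewrite setTI -comp_preimage -[X in measurable X]setTI.
exact: mf.
Qed.

Section lebesgue_rV.
Context {R : realType}.

Definition rV_cons (n : nat) (p : measurableTypeR R * 'rV[R]_n) : 'rV[R]_n.+1 :=
  row_mx (p.1)%:M p.2.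

Lemma rV_cons0 n p : @rV_cons n p 0 ord0 = p.1.
Proof.
by rewrite mxE; case: splitP => [j _|j //]; rewrite ord1 mxE eqxx mulr1n.
Qed.

Lemma rV_consS n p (i : 'I_n) : @rV_cons n p 0 (lift ord0 i) = p.2 0 i.
Proof.
rewrite mxE; case: splitP => [[[]//]|j]; rewrite /= /bump/= add1n => -[ij].
by congr (p.2 0 _); exact/val_inj.
Qed.

Lemma measurable_rV_cons n : measurable_fun setT (@rV_cons n).
Proof.
apply: measurable_fun_rVP => i; case: (unliftP ord0 i) => [j|] ->.
  rewrite (_ : _ \o _ = rV_coord j \o snd); last first.
    by apply/funext => p; rewrite /= /rV_coord rV_consS.
  by apply: measurableT_comp => //; exact: measurable_rV_coord.
rewrite (_ : _ \o _ = fst) //.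
by apply/funext => p; rewrite /= /rV_coord rV_cons0.
Qed.

Definition rV_box n (A : 'I_n -> set R) : set 'rV[R]_n :=
  [set v | forall i, A i (v 0 i)].

Lemma measurable_rV_box n (A : 'I_n -> set (measurableTypeR R)) :
  (forall i, measurable (A i)) -> measurable (rV_box A : set 'rV[R]_n).
Proof.
move=> mA.
rewrite (_ : rV_box A = \big[setI/setT]_(i < n) (rV_coord i @^-1` A i)).
  apply: bigsetI_measurable => i _; rewrite -[X in measurable X]setTI.
  exact: measurable_rV_coord.
rewrite -bigcap_seq; apply/seteqP; split => v /=.
  by move=> vA i _; exact: vA.
by move=> vA i; apply: vA => /=; rewrite mem_index_enum.
Qed.

Lemma rV_cons_box n (A : 'I_n.+1 -> set R) :
  @rV_cons n @^-1` rV_box A = A ord0 `*` rV_box (A \o lift ord0).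
Proof.
apply/seteqP; split => [p /= pA|p /= [p0 pA] i].
  split; first by have := pA ord0; rewrite rV_cons0.
  by move=> i /=; have := pA (lift ord0 i); rewrite rV_consS.
by case: (unliftP ord0 i) => [j|] ->; rewrite ?rV_consS ?rV_cons0//; exact: pA.
Qed.

Definition rV_uncons (n : nat) (v : 'rV[R]_n.+1) :
  measurableTypeR R * 'rV[R]_n := (v 0 ord0, \row_i v 0 (lift ord0 i)).

Lemma rV_consK n : cancel (@rV_cons n) (@rV_uncons n).
Proof.
move=> [x v]; rewrite /rV_uncons rV_cons0; congr pair.
by apply/rowP => i; rewrite mxE rV_consS.
Qed.

Lemma measurable_rV_uncons n : measurable_fun setT (@rV_uncons n).
Proof.
apply: measurable_fun_pair => /=; first exact: (measurable_rV_coord ord0).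
apply: measurable_fun_rVP => i.
rewrite (_ : _ \o _ = rV_coord (lift ord0 i)); first exact: measurable_rV_coord.
by apply/funext => v; rewrite /= /rV_coord mxE.
Qed.

Section lebesgue_rV_cons.
Context {n : nat} (m : {sigma_finite_measure set 'rV[R]_n -> \bar R}).
Local Open Scope ereal_scope.

Definition lebesgue_rV_cons : set 'rV[R]_n.+1 -> \bar R :=
  pushforward (lebesgue_measure \x m) (@rV_cons n).

Let pm : {measure set 'rV[R]_n.+1 -> \bar R} :=
  measure_function_pushforward__canonical__measure_function_Measure
    (lebesgue_measure \x m)%E (@measurable_rV_cons n).

HB.instance Definition _ := isMeasure.Build _ _ _ lebesgue_rV_cons
  (measure0 pm) (measure_ge0 pm) (@measure_semi_sigma_additive _ _ _ pm).

Let sigma_finite_lebesgue_rV_cons : sigma_finite setT lebesgue_rV_cons.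
Proof.
have /sigma_finiteP[F [TF ndF Foo]] := sigma_finiteT (@lebesgue_measure R).
have /sigma_finiteP[G [TG ndG Goo]] := sigma_finiteT m.
exists (fun k => @rV_uncons n @^-1` (F k `*` G k)).
  rewrite -preimage_bigcup; apply/esym/seteqP; split=> // v _.
  have [i _ Fi] : (\bigcup_i F i) (v 0%R ord0) by rewrite -TF.
  have [j _ Gj] : (\bigcup_i G i) (rV_uncons v).2 by rewrite -TG.
  exists (maxn i j) => //; split => /=.
  - by move: (v 0%R ord0) Fi; exact/subsetPset/ndF/leq_maxl.
  - by move: Gj; apply: (subsetPset _ _ (ndG _ _ (leq_maxr _ _))).
move=> k; have [mF Fk] := Foo k; have [mG Gk] := Goo k; split.
  rewrite -[X in measurable X]setTI; apply: measurable_rV_uncons => //.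
  exact: measurableX.
rewrite /lebesgue_rV_cons /pushforward -comp_preimage.
rewrite (_ : _ \o _ = idfun); last by apply/funext => p; exact: rV_consK.
by rewrite preimage_id product_measure1E// lte_mul_pinfty// ge0_fin_numE.
Qed.

HB.instance Definition _ := Measure_isSigmaFinite.Build _ _ _ lebesgue_rV_cons
  sigma_finite_lebesgue_rV_cons.
End lebesgue_rV_cons.

Fixpoint lebesgue_rV (n : nat) : {sigma_finite_measure set 'rV[R]_n -> \bar R} :=
  if n is k.+1 then lebesgue_rV_cons (lebesgue_rV k) else \d_(0 : 'rV[R]_0).

Lemma lebesgue_rV_box n (A : 'I_n -> set (measurableTypeR R)) :
  (forall i, measurable (A i)) ->
  lebesgue_rV n (rV_box A) = (\prod_(i < n) lebesgue_measure (A i))%E.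
Proof.
elim: n A => [|n IHn] A mA.
  by rewrite big_ord0 /= diracE mem_set// => -[].
rewrite big_ord_recl -IHn => [|i]; last exact: mA.
rewrite /= /lebesgue_rV_cons /pushforward rV_cons_box product_measure1E//.
by apply: measurable_rV_box => i; exact: mA.
Qed.

End lebesgue_rV.

Section euclidean.
Context {R : realType} {N : nat}.
Implicit Types (x y : 'rV[R]_N) (U : set 'rV[R]_N) (phi : 'rV[R]_N -> R).

(* The norm `|x| that the library puts on 'rV[R]_N is the sup norm, which has
   the same open and the same bounded sets. *)
Definition enorm x : R := Num.sqrt (\sum_i x 0 i ^+ 2).

Definition eball (r : R) : set 'rV[R]_N := [set y | enorm y < r].

Definition ext0 U phi : 'rV[R]_N -> R := patch (fun=> 0) U phi.

(* phi restricted to U is in C^alpha(U). Used with U compact, where the Hoelder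
   bound implies that phi is bounded on U. *)
Definition holder (alpha : R) U phi :=
  exists C : R, forall x y, U x -> U y ->
    `|phi x - phi y| <= C * enorm (x - y) `^ alpha.

Definition continuity_modulus phi x (r : R) : \bar R :=
  ereal_sup [set `|phi y - phi x|%:E | y in [set y | enorm (y - x) <= r]].

Definition dini_continuous_at phi x :=
  (\int[lebesgue_measure]_(r in `]0%R, 1%R[)
     (continuity_modulus phi x r * (r^-1)%:E) < +oo)%E.

End euclidean.

Section log_laplacian.
Context {R : realType}.

Definition Gamma (s : R) : R :=
  \int[lebesgue_measure]_(t in `]0, +oo[) (t `^ (s - 1) * expR (- t)).

Definition digamma (s : R) : R := derive1 Gamma s / Gamma s.

Definition euler_gamma : R := - derive1 Gamma 1.

Definition c_ (N : nat) : R := Gamma (N%:R / 2) / pi `^ (N%:R / 2).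

Definition rho_ (N : nat) : R :=
  2 * ln 2 + digamma (N%:R / 2) - euler_gamma.

Context {N : nat}.
Implicit Types (x : 'rV[R]_N) (phi : 'rV[R]_N -> R).

Definition log_laplacian_domain phi x :=
  [/\ measurable_fun [set: 'rV[R]_N] phi,
      (\int[lebesgue_rV N]_z ((1 + enorm z) ^- N * `|phi z|)%:E < +oo)%E &
      dini_continuous_at phi x].

(* Real-valued integrals and limits are total operators in the library;
   log_laplacian phi x is meaningful under log_laplacian_domain phi x. *)
Definition log_laplacian phi x : R :=
  c_ N * lim ((\int[lebesgue_rV N]_(y in eball 1 `\` eball e)
                 ((phi x - phi (x + y)) / enorm y ^+ N)) @[e --> 0^'+])
  - c_ N * \int[lebesgue_rV N]_(y in ~` eball 1) (phi (x + y) / enorm y ^+ N)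
  + rho_ N * phi x.

End log_laplacian.

(* Main.v *)
Require Import Defs.
From mathcomp Require Import all_boot all_order all_algebra.
From mathcomp Require Import all_classical all_reals all_analysis.
From mathcomp Require Import measurable_realfun ring lra.

Import Order.TTheory GRing.Theory Num.Theory.
Import numFieldNormedType.Exports.

Local Open Scope classical_set_scope.
Local Open Scope ring_scope.

(* Write phi and phi' for the extensions of f from Omega and Omega'. For x in
   Omega' both satisfy a Hoelder bound at x, so the principal value is the
   Lebesgue integral over the unit ball of a function dominated by
   |y|^(alpha - N). The two Laplacians can then be subtracted under the
   integral: as phi(x) = phi'(x), their difference is c_N times the integral
   over the whole space of (phi - phi')(x + y) / |y|^N, and translating by x
   gives the claim. *)

(** * Translation invariance of the measure on row vectors *)

(** The pushforward under the translation gives each interval []u, v]] its length, and this property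
    characterises Lebesgue measure. *)
Lemma lebesgue_measure_translation (R : realType) (a : R)
    (A : set (measurableTypeR R)) : measurable A ->
  lebesgue_measure ((fun x : R => x + a) @^-1` A) = lebesgue_measure A.
Proof.
move=> mA.
have mT : measurable_fun setT
    (fun x : measurableTypeR R => x + a : measurableTypeR R).
  by apply: measurable_funD => //; exact: measurable_cst.
pose m' := measure_function_pushforward__canonical__measure_function_Measure
  (@lebesgue_measure R) mT.
apply/esym; apply: (@lebesgue_measure_unique R m') => //.
move=> X /ocitvP[->|[x x12 ->]].
  by rewrite !measure0.
rewrite /m' /= /pushforward.
have -> : (fun u : R => u + a) @^-1` `]x.1, x.2] =
    `](x.1 - a), (x.2 - a)]%classic.
  by apply/seteqP; split => u /=; rewrite !in_itv/= ltrBlDr lerBrDr.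
rewrite !lebesgue_measure_itv/= !lte_fin ltrD2r x12 -!EFinD.
by rewrite opprD opprK addrACA addNr addr0.
Qed.

Lemma measurable_rV_translation (R : realType) (n : nat) (a : 'rV[R]_n) :
  measurable_fun setT (fun v : 'rV[R]_n => v + a).
Proof.
apply: measurable_fun_rVP => i.
rewrite (_ : _ \o _ = (fun v : 'rV[R]_n => rV_coord i v + a 0 i)).
  by apply: measurable_funD; [exact: measurable_rV_coord|exact: measurable_cst].
by apply/funext => v; rewrite /= /rV_coord mxE.
Qed.

(** By induction on [n]: through [rV_cons] the translation acts separately on the first coordinate
    and on the rest, so its pushforward agrees with the product measure on rectangles, hence
    everywhere. *)
Lemma lebesgue_rV_translation (R : realType) (n : nat) (a : 'rV[R]_n)
    (A : set 'rV[R]_n) : measurable A ->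
  lebesgue_rV n ((fun v : 'rV[R]_n => v + a) @^-1` A) = lebesgue_rV n A.
Proof.
elim: n a A => [|n IHn] a A mA.
  congr (lebesgue_rV 0 _); apply/seteqP; split => v /=;
    by rewrite (_ : v + a = v)//; apply/rowP => -[].
rewrite /= /lebesgue_rV_cons /pushforward.
set b := (rV_uncons a).2.
pose T := fun p : measurableTypeR R * 'rV[R]_n =>
  (p.1 + a 0 ord0 : measurableTypeR R, p.2 + b).
have mT : measurable_fun setT T.
  apply: measurable_fun_pair => /=.
    by apply: measurable_funD => //; exact: measurable_cst.
  apply: (@measurableT_comp _ _ _ _ _ _ (fun v : 'rV[R]_n => v + b)) => //.
  exact: measurable_rV_translation.
have TE : @rV_cons R n @^-1` ((fun v => v + a) @^-1` A) =
    T @^-1` (@rV_cons R n @^-1` A).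
  apply/seteqP; split => p /=;
    rewrite (_ : rV_cons p + a = rV_cons (T p))//;
    apply/rowP => i; case: (unliftP ord0 i) => [j|] ->;
    by rewrite mxE ?rV_consS ?rV_cons0// /T /b /= !mxE.
rewrite TE.
pose m' := measure_function_pushforward__canonical__measure_function_Measure
  (@lebesgue_measure R \x lebesgue_rV n)%E mT.
apply/esym; apply: (@product_measure_unique _ _ _ _ _ _ _ m'); last first.
  by rewrite -[X in measurable X]setTI; exact: measurable_rV_cons.
move=> B C mB mC; rewrite /m' /= /pushforward.
rewrite (_ : T @^-1` (B `*` C) = ((fun x : R => x + a 0 ord0) @^-1` B) `*`
  ((fun v => v + b) @^-1` C))//.
rewrite product_measure1E; last 2 first.
- rewrite -[X in measurable X]setTI; apply: measurable_funD => //.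
- by rewrite -[X in measurable X]setTI; exact: measurable_rV_translation.
by congr (_ * _)%E; [exact: lebesgue_measure_translation|exact: IHn].
Qed.

(** Integration against the pushforward of the measure, which by invariance is the measure
    itself. *)
Lemma Rintegral_translation (R : realType) (n : nat) (a : 'rV[R]_n)
    (g : 'rV[R]_n -> R) : measurable_fun setT g ->
  (lebesgue_rV n).-integrable setT (EFin \o (fun y => g (y + a))) ->
  \int[lebesgue_rV n]_y g (y + a) = \int[lebesgue_rV n]_y g y.
Proof.
move=> mg ig; rewrite /Rintegral; congr fine.
pose mu' := measure_function_pushforward__canonical__measure_function_Measure
  (lebesgue_rV n) (measurable_rV_translation _ _ a).
rewrite -[LHS](@integral_pushforward _ _ _ _ _ _
  (measurable_rV_translation _ _ a) (lebesgue_rV n) setT (EFin \o g))//; last exact/measurable_EFinP.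
apply: (@eq_measure_integral _ _ _ _ _ mu') => A mA _.
exact: lebesgue_rV_translation.
Qed.

(** * Measurability of open sets *)

(** An open set is the union of the boxes inside it that have a rational centre and a radius
    [1/(k+1)]. There are countably many of them, and boxes are measurable. *)
Lemma open_measurable_rV (R : realType) (n : nat) (A : set 'rV[R]_n) :
  open A -> measurable A.
Proof.
move=> oA.
pose box (p : 'rV[rat]_n * nat) : set 'rV[R]_n :=
  rV_box (fun i => ball (ratr (p.1 0 i) : R) (p.2.+1%:R^-1)).
have -> : A = \bigcup_p if `[< box p `<=` A >] then box p else set0.
  apply/seteqP; split => [x Ax|x [p _]]; last first.
    by case: asboolP => // bA; exact: bA.
  have /nbhs_ballP[e /= e0 eA] : nbhs x A by exact: open_nbhs_nbhs.
  (* Two radii have to fit into [e]: one from [x] to the rational centre, one from the centre to a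
     point of the box. *)
  have [k ke] : exists k : nat, k.+1%:R^-1 + k.+1%:R^-1 < e.
    have e20 : 0 < e / 2 by rewrite divr_gt0.
    have [k _ /(_ k (leqnn k)) /= ke] := near_infty_natSinv_lt (PosNum e20).
    by exists k; rewrite [ltRHS](splitr e) ltrD.
  have q_ (i : 'I_n) : exists q : rat, `|x 0 i - ratr q| < k.+1%:R^-1.
    have k0 : 0 < k.+1%:R^-1 :> R by rewrite invr_gt0.
    have [q] := @rat_in_itvoo R (x 0 i - k.+1%:R^-1) (x 0 i + k.+1%:R^-1)
      ltac:(by rewrite ltrD2l gt0_cp).
    by rewrite in_itv/= => xq; exists q; rewrite distrC ltr_distl.
  pose q := \row_i projT1 (cid (q_ i)).
  have xq i : `|x 0 i - ratr (q 0 i)| < k.+1%:R^-1.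
    by rewrite mxE; case: cid.
  exists (q, k) => //=; rewrite asboolT => [i|y qy].
    by rewrite -ball_normE /= distrC.
  apply: eA; split => // i j; rewrite ord1 -ball_normE /=.
  have := qy j; rewrite /= -ball_normE /= => yq.
  apply: le_lt_trans ke; apply/ltW.
  by rewrite (le_lt_trans (ler_distD (ratr (q 0 j)) _ _))// ltrD.
apply: countable_bigcupT_measurable => [|p]; first exact: countableP.
case: asboolP => // _; apply: measurable_rV_box => i.
by apply: measurable_ball.
Qed.

(* Dropping the measurability hypotheses of [ge0_le_integral] avoids proving
   that continuity moduli are measurable. *)
Lemma ge0_le_integral_nonmeasurable d (T : measurableType d) (R : realType)
    (mu : {measure set T -> \bar R}) (D : set T) (f g : T -> \bar R) :
  (forall x, D x -> (0 <= f x)%E) -> (forall x, D x -> (f x <= g x)%E) ->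
  (\int[mu]_(x in D) f x <= \int[mu]_(x in D) g x)%E.
Proof.
move=> f0 fg.
have g0 x : D x -> (0 <= g x)%E
  by move=> Dx; exact: le_trans (f0 _ Dx) (fg _ Dx).
rewrite !(integral_mkcond D) !ge0_integralTE; [|exact: erestrict_ge0..].
apply: ereal_sup_le => _ [h /= hf <-]; exists h => // x.
apply: le_trans (hf x) _; rewrite /patch.
by case: ifPn => // /set_mem Dx; exact: fg.
Qed.

(** * The Euclidean norm, its balls, and integrals of its powers *)

Lemma enorm_ge0 (R : realType) (n : nat) (x : 'rV[R]_n) : 0 <= enorm x.
Proof. exact: sqrtr_ge0. Qed.

Lemma le_coord_enorm (R : realType) (n : nat) (x : 'rV[R]_n) (i : 'I_n) :
  `|x 0 i| <= enorm x.
Proof.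
rewrite -sqrtr_sqr ler_wsqrtr// (bigD1 i)//= lerDl.
by apply: sumr_ge0 => j _; exact: sqr_ge0.
Qed.

(** Each of the [n] squares is at most the square of the sup norm, and [n <= n^2]. With
    [le_coord_enorm] this compares the two norms; the size of the constant is immaterial. *)
Lemma enorm_le (R : realType) (n : nat) (x : 'rV[R]_n) : enorm x <= n%:R * `|x|.
Proof.
rewrite -(ger0_norm (mulr_ge0 (ler0n R n) (normr_ge0 x))) -sqrtr_sqr.
rewrite ler_wsqrtr//.
have xi i : x 0 i ^+ 2 <= `|x| ^+ 2.
  rewrite -[leLHS]real_normK ?num_real// ler_sqr ?nnegrE//.
  rewrite [leRHS](_ : _ = mx_norm x)// mx_normrE.
  exact: (le_bigmax _ (fun ij => `|x ij.1 ij.2|) (0, i)).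
apply: (@le_trans _ _ (n%:R * `|x| ^+ 2)).
  rewrite mulr_natl -[X in _ *+ X](card_ord n) -sumr_const.
  by apply: ler_sum => i _.
rewrite exprMn ler_wpM2r ?sqr_ge0//.
by rewrite -natrX ler_nat -mulnn; case: (n) => // k; rewrite leq_pmulr.
Qed.

Lemma enormN (R : realType) (n : nat) (x : 'rV[R]_n) : enorm (- x) = enorm x.
Proof.
by rewrite /enorm; congr Num.sqrt; apply: eq_bigr => i _; rewrite mxE sqrrN.
Qed.

Lemma enorm0 (R : realType) (n : nat) : enorm (0 : 'rV[R]_n) = 0.
Proof. by rewrite /enorm big1 ?sqrtr0// => i _; rewrite mxE expr0n. Qed.

Lemma measurable_enorm (R : realType) (n : nat) :
  measurable_fun setT (@enorm R n).
Proof.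
rewrite (_ : enorm = fun x => (\sum_i rV_coord i x ^+ 2) `^ 2^-1); last first.
  by apply/funext => x; rewrite powR12_sqrt// sumr_ge0// => i _; exact: sqr_ge0.
apply: (measurableT_comp (measurable_powR _)); apply: measurable_sum => i.
by apply: measurable_funX; exact: measurable_rV_coord.
Qed.

Lemma measurable_eball (R : realType) (n : nat) (r : R) :
  measurable (@eball R n r).
Proof.
rewrite -[X in measurable X]setTI (_ : eball r = @enorm R n @^-1` `]-oo, r[).
  exact: measurable_enorm.
by apply/seteqP; split => x /=; rewrite in_itv.
Qed.

(** The ball lies in a cube of side [2 * r]; only the order [r ^ n] matters below. *)
Lemma lebesgue_rV_eball (R : realType) (n : nat) (r : R) : 0 < r ->
  (lebesgue_rV n (eball r) <= (2 ^+ n * r ^+ n)%:E)%E.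
Proof.
move=> r0.
pose B : set 'rV[R]_n := rV_box (fun=> `](- r), r[%classic).
apply: (@le_trans _ _ (lebesgue_rV n B)).
  apply: le_measure; rewrite ?inE.
  - exact: measurable_eball.
  - by apply: measurable_rV_box => i; exact: measurable_itv.
  move=> x xr i /=; rewrite in_itv/= -ltr_norml.
  exact: le_lt_trans (le_coord_enorm _ _ _ _) xr.
rewrite lebesgue_rV_box => [|i]; last exact: measurable_itv.
under eq_bigr do rewrite lebesgue_measure_itv/= lte_fin gtrN// -EFinD opprK.
by rewrite -exprMn prodEFin prodr_const card_ord mulr_natl mulr2n.
Qed.

(* A dyadic substitute for polar coordinates: [f] is dominated by
   [\sum_k a_k \1_{rho < 2^-k}] with [a_k] of order [2^(k (n - alpha))], while
   the set [{rho < 2^-k}] has measure of order [2^(- k n)]. *)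
Lemma integral_dyadic_lty d (T : measurableType d) (R : realType)
    (mu : {measure set T -> \bar R}) (D : set T) (rho : T -> R) (n : nat)
    (L K alpha : R) (f : T -> \bar R) :
  measurable D -> measurable_fun D rho ->
  (forall t, D t -> 0 <= rho t < 1) ->
  (forall r, 0 < r ->
    (mu (D `&` [set t | (rho t < r)%R]) <= (L * r ^+ n)%:E)%E) ->
  0 < alpha -> 0 <= K ->
  (forall t, D t -> (0 <= f t <= (K * rho t `^ alpha / rho t ^+ n)%:E)%E) ->
  (\int[mu]_(t in D) f t < +oo)%E.
Proof.
move=> mD mrho rho01 muL alpha0 K0 fK.
pose h : R := 2^-1.
have h0 : 0 < h by rewrite invr_gt0.
(* On the shell [h^(k+1) <= rho < h^k] the numerator is largest at the outer radius and the
   denominator smallest at the inner one. *)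
pose a k : R := K * (h ^+ k) `^ alpha / (h ^+ k.+1) ^+ n.
pose A k := D `&` [set t | rho t < h ^+ k].
have a0 k : 0 <= a k.
  by rewrite divr_ge0 ?mulr_ge0 ?powR_ge0// exprn_ge0// exprn_ge0// ltW.
have mA k : measurable (A k).
  rewrite /A (_ : [set t | _] = rho @^-1` `]-oo, h ^+ k[); first exact: mrho.
  by apply/seteqP; split => x /=; rewrite in_itv.
have ma k : measurable_fun D (fun t => (a k * \1_(A k) t)%:E).
  apply/measurable_EFinP; apply: measurable_funM; first exact: measurable_cst.
  exact: measurable_indic.
have p0 k t : (0 <= (a k * \1_(A k) t)%:E)%E.
  by rewrite lee_fin mulr_ge0// indicE ler0n.
apply: (@le_lt_trans _ _
  (\int[mu]_(t in D) \sum_(k <oo) (a k * \1_(A k) t)%:E)%E).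
  apply: ge0_le_integral_nonmeasurable => t Dt;
    have /andP[f0 fKt] := fK _ Dt => //.
  apply: le_trans fKt _.
  have /andP[r0 r1] := rho01 _ Dt.
  (* Where [rho t = 0] the bound on [f t] is zero, because [powR] gives [0] for a nonzero exponent
     at [0]. *)
  move: r0; rewrite le_eqVlt => /predU1P[<-|r0].
    by rewrite powR0 ?gt_eqF// mulr0 mul0r nneseries_ge0.
  have ex : exists m, h ^+ m <= rho t.
    have rp : 0 < rho t by [].
    have [m _ /(_ m (leqnn m)) /= hm] := near_infty_natSinv_lt (PosNum rp).
    exists m; apply: le_trans (ltW hm).
    by rewrite /h exprVn lef_pV2 ?posrE ?exprn_gt0// -natrX ler_nat ltn_expl.
  (* The least exponent [m] with [h^m <= rho t] is not [0], as [rho t < 1]; writing it as [k+1]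
     places [t] in the [k]-th shell. *)
  case: (ex_minnP ex) => -[|k]; first by rewrite expr0 leNgt r1.
  move=> hk kmin.
  have {}kmin : rho t < h ^+ k
    by rewrite ltNge; apply/negP => /kmin; rewrite ltnn.
  apply: (@le_trans _ _ (a k * \1_(A k) t)%:E).
    rewrite indicE mem_set//= mulr1 lee_fin /a.
    apply: ler_pM.
    - by rewrite mulr_ge0// powR_ge0.
    - by rewrite invr_ge0 exprn_ge0// ltW.
    - apply: ler_wpM2l => //; apply: ge0_ler_powR;
        rewrite ?nnegrE ?exprn_ge0// ltW//.
    - rewrite lef_pV2 ?posrE ?exprn_gt0//; apply: lerXn2r => //;
        rewrite ?nnegrE ?exprn_ge0// ltW//.
  (* A single term of a nonnegative series is at most its sum. *)
  rewrite (@nneseriesD1 _ _ k)// leeDl//.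
  by apply: nneseries_ge0 => j _ _; exact: p0.
rewrite integral_nneseries//.
pose q := h `^ alpha.
have q0 : 0 <= q by exact: powR_ge0.
have q1 : q < 1.
  rewrite -(powRr0 h) /q /powR gt_eqF// ltr_expR mul0r nmulr_llt0//.
  by apply: ln_lt0; rewrite h0 invf_lt1 ?ltr1n.
(* The measure bound [L * (h^k)^n] cancels the denominator of [a k] up to [h^n], which gives [2^n].
   What remains is geometric with ratio [q = h^alpha < 1]. *)
pose c : R := K * 2 ^+ n * L.
apply: (@le_lt_trans _ _ (\sum_(k <oo) (c * q ^+ k)%:E)%E).
  apply: lee_nneseries => [k _ _|k _]; first exact: integral_ge0.
  under eq_integral do rewrite EFinM.
  rewrite ge0_integralZl//; last 2 first.
  - exact/measurable_EFinP/measurable_indic.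
  - by rewrite lee_fin.
  rewrite integral_indic// setIidl; last by move=> t [].
  apply: (@le_trans _ _ ((a k)%:E * (L * (h ^+ k) ^+ n)%:E)%E).
    by apply: lee_wpmul2l; [rewrite lee_fin|apply: muL; rewrite exprn_gt0].
  rewrite -EFinM lee_fin /a /c.
  have -> : (h ^+ k) `^ alpha = q ^+ k.
    by rewrite -!powR_mulrn ?powR_ge0 ?ltW// /q -!powRrM mulrC.
  rewrite exprS exprMn (_ : 2 ^+ n = (h ^+ n)^-1); last by rewrite exprVn invrK.
  have hn : h ^+ n != 0 by rewrite expf_neq0// gt_eqF.
  have hkn : (h ^+ k) ^+ n != 0 by rewrite !expf_neq0// gt_eqF.
  rewrite le_eqVlt; apply/orP; left; apply/eqP.
  by move: (h ^+ n) ((h ^+ k) ^+ n) hn hkn => u v u0 v0; field; rewrite u0 v0.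
rewrite (_ : (fun k => _) = EFin \o series (geometric c q)); last first.
  by apply/funext => k /=; rewrite sumEFin.
by rewrite EFin_lim ?ltry//; apply: is_cvg_geometric_series; rewrite ger0_norm.
Qed.

(** * Neighbourhoods and boundedness in terms of the Euclidean norm *)

Lemma near_enorm_lt (R : realType) (n : nat) (x : 'rV[R]_n) (e : R) :
  0 < e -> \forall y \near x, enorm (y - x) < e.
Proof.
move=> e0; near=> y; apply: le_lt_trans (enorm_le _ _ _) _.
(* Dividing by [n.+1] instead of [n] covers dimension [0]. *)
have : `|y - x| < e / n.+1%:R.
  by rewrite distrC; near: y; apply: cvgr_dist_lt => //; rewrite divr_gt0.
rewrite ltr_pdivlMr// => yx; apply: le_lt_trans yx.
by rewrite mulrC ler_wpM2l// ler_nat.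
Unshelve. all: by end_near. Qed.

Lemma enorm_lt_near (R : realType) (n : nat) (x : 'rV[R]_n)
    (P : 'rV[R]_n -> Prop) : (\forall y \near x, P y) ->
  exists2 e : R, 0 < e & forall y, enorm (y - x) < e -> P y.
Proof.
move=> /nbhs_ballP[e /= e0 eP]; exists e => // y yx; apply: eP.
split => // i j; rewrite ord1 -ball_normE /= distrC.
by apply: le_lt_trans yx; have := le_coord_enorm _ _ (y - x) j; rewrite !mxE.
Qed.

Lemma bounded_set_enorm (R : realType) (n : nat) (U : set 'rV[R]_n) :
  bounded_set U -> exists2 r : R, 0 < r & U `<=` eball r.
Proof.
move=> [M [_ /(_ (M + 1))]]; rewrite ltrDl => /(_ ltr01) UM.
exists (n%:R * `|M + 1| + 1) => [|y Uy].
  by rewrite ltr_wpDl// mulr_ge0.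
rewrite /eball /=; apply: le_lt_trans (enorm_le _ _ _) _.
by rewrite ltr_pwDr// ler_wpM2l// (le_trans (UM _ Uy))// ler_norm.
Qed.

(** * Extensions by zero of Hoelder functions *)

Lemma holder_sub (R : realType) (n : nat) (alpha : R) (U V : set 'rV[R]_n)
    (f : 'rV[R]_n -> R) : U `<=` V -> holder alpha V f -> holder alpha U f.
Proof.
by move=> UV [C fC]; exists C => x y Ux Uy; apply: fC; exact: UV.
Qed.

(* The jump of [ext0 U f] across the boundary of [U] is harmless, as it takes
   place at a positive distance from [x]. *)
Lemma ext0_holder_at (R : realType) (n : nat) (alpha : R) (U : set 'rV[R]_n)
    (f : 'rV[R]_n -> R) (x : 'rV[R]_n) :
  0 < alpha -> open U -> holder alpha U f -> U x ->
  exists2 K : R, 0 <= K & forall y,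
    `|ext0 U f y - ext0 U f x| <= K * enorm (y - x) `^ alpha.
Proof.
move=> alpha0 oU [C fC] Ux.
have [e e0 eU] : exists2 e : R, 0 < e & forall y, enorm (y - x) < e -> U y.
  by apply: enorm_lt_near; exact: open_nbhs_nbhs.
have ea0 : 0 < e `^ alpha by exact: powR_gt0.
(* The first summand serves [y] in [U]. Outside [U] the distance to [x] is at least [e], so the
   second one bounds the increment [|f x|]. The absolute value is there because [C] may be
   negative. *)
exists (`|C| + `|f x| / e `^ alpha) => [|y].
  by rewrite addr_ge0// divr_ge0// powR_ge0.
rewrite /ext0 /patch [x \in U]mem_set// mulrDl.
case: ifPn => [/set_mem Uy|/negP Uy].
  apply: (@le_trans _ _ (`|C| * enorm (y - x) `^ alpha)).
    by apply: le_trans (fC _ _ Uy Ux) _; rewrite ler_wpM2r ?powR_ge0 ?ler_norm.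
  by rewrite lerDl mulr_ge0 ?powR_ge0 ?divr_ge0 ?powR_ge0.
have ey : e <= enorm (y - x).
  by rewrite leNgt; apply/negP => /eU Uy'; apply: Uy; exact: mem_set.
rewrite sub0r normrN -[leLHS]add0r lerD ?mulr_ge0 ?powR_ge0//.
rewrite -mulrA ler_peMr// mulrC ler_pdivlMr// mul1r.
by apply: ge0_ler_powR; rewrite ?nnegrE ?enorm_ge0// ltW.
Qed.

(** The Hoelder bound makes [f] continuous on the open set [U], so the points of [U] where [f]
    exceeds [r] form an open set. *)
Lemma measurable_ext0 (R : realType) (n : nat) (alpha : R) (U : set 'rV[R]_n)
    (f : 'rV[R]_n -> R) :
  0 < alpha -> open U -> holder alpha U f ->
  measurable_fun [set: 'rV[R]_n] (ext0 U f).
Proof.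
move=> alpha0 oU hf.
apply/(measurable_restrictT f (open_measurable_rV _ _ _ oU)) => mU.
apply: (measurability _ (RGenOInfty.measurableE R)) => // _ [_ [r ->] <-].
apply: open_measurable_rV; rewrite openE => x [Ux /=].
rewrite in_itv/= andbT => rx.
have [K K0 fK] := ext0_holder_at _ _ _ _ _ _ alpha0 oU hf Ux.
have K10 : 0 < K + 1 by rewrite ltr_wpDl.
(* Solves [(K + 1) * d^alpha = f x - r], so within distance [d] of [x] the values stay above [r].
   The factor [K + 1] is positive even if [K = 0]. *)
pose d := ((f x - r) / (K + 1)) `^ alpha^-1.
have fxr : 0 < (f x - r) / (K + 1) by rewrite divr_gt0 ?subr_gt0.
have d0 : 0 < d by rewrite powR_gt0.
near=> y.
have Uy : U y by near: y; exact: open_nbhs_nbhs.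
have yxd : enorm (y - x) < d by near: y; exact: near_enorm_lt.
split => //=; rewrite in_itv/= andbT.
have := fK y; rewrite /ext0 /patch !mem_set// ler_distl => /andP[+ _].
apply: lt_le_trans.
have : enorm (y - x) `^ alpha < (f x - r) / (K + 1).
  have -> : (f x - r) / (K + 1) = d `^ alpha.
    by rewrite /d -powRrM mulVf ?lt0r_neq0// powRr1// ltW.
  by apply: gt0_ltr_powR => //; rewrite nnegrE ?enorm_ge0// ltW.
rewrite ltr_pdivlMr// mulrC => h.
move: h; rewrite mulrDl mul1r => h.
rewrite ltrBrDl -ltrBrDr; apply: le_lt_trans h.
by rewrite lerDl powR_ge0.
Unshelve. all: by end_near. Qed.

(** The Hoelder bound compares every value on [U] with the value at one fixed point, at a distance
    that is bounded since [U] is. *)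
Lemma bounded_ext0 (R : realType) (n : nat) (alpha : R) (U : set 'rV[R]_n)
    (f : 'rV[R]_n -> R) :
  0 <= alpha -> bounded_set U -> holder alpha U f ->
  exists2 M : R, 0 <= M & forall y, `|ext0 U f y| <= M.
Proof.
move=> alpha0 bU [C fC].
have [[x Ux]|nU] := pselect (exists x, U x); last first.
  exists 0 => // y; rewrite /ext0 /patch; case: ifPn => [/set_mem Uy|_].
    by exfalso; apply: nU; exists y.
  by rewrite normr0.
move: bU => [B [_ /(_ (B + 1))]]; rewrite ltrDl => /(_ ltr01) UB.
set b := n%:R * (`|B + 1| + `|x|).
have b0 : 0 <= b by rewrite mulr_ge0// addr_ge0.
exists (`|f x| + `|C| * b `^ alpha) => [|y].
  by rewrite addr_ge0// mulr_ge0// powR_ge0.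
rewrite /ext0 /patch; case: ifPn => [/set_mem Uy|_]; last first.
  by rewrite normr0 addr_ge0// mulr_ge0// powR_ge0.
rewrite -[f y](subrK (f x)) addrC; apply: le_trans (ler_normD _ _) _.
rewrite lerD2l; apply: le_trans (fC _ _ Uy Ux) _.
apply: (@le_trans _ _ (`|C| * enorm (y - x) `^ alpha)).
  by rewrite ler_wpM2r ?powR_ge0 ?ler_norm.
rewrite ler_wpM2l// ge0_ler_powR ?nnegrE ?enorm_ge0//.
apply: le_trans (enorm_le _ _ _) _; rewrite ler_wpM2l//.
apply: le_trans (ler_normB _ _) _; rewrite lerD2r.
by apply: le_trans (UB _ Uy) _; exact: ler_norm.
Qed.

(** * The logarithmic Laplacian at a point with a Hoelder bound *)

Section log_laplacian_holder.
Context (R : realType) (N : nat) (phi : 'rV[R]_N -> R) (x : 'rV[R]_N).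
Context (alpha K M r : R).
Hypothesis mphi : measurable_fun [set: 'rV[R]_N] phi.
Hypothesis alpha0 : 0 < alpha.
Hypothesis K0 : 0 <= K.
Hypothesis M0 : 0 <= M.
Hypothesis r0 : 0 < r.
Hypothesis phiK : forall y, `|phi y - phi x| <= K * enorm (y - x) `^ alpha.
Hypothesis phiM : forall y, `|phi y| <= M.
Hypothesis phir : forall y, ~ eball r y -> phi y = 0.

Notation mu := (lebesgue_rV N).

Lemma measurable_div_enorm (g : 'rV[R]_N -> R) :
  measurable_fun [set: 'rV[R]_N] g ->
  measurable_fun [set: 'rV[R]_N] (fun y => g y / enorm y ^+ N).
Proof.
move=> mg; apply: measurable_funM => //.
rewrite (_ : (fun y => _) = fun y : 'rV[R]_N => (enorm y ^+ N) `^ (-1)).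
  apply: (measurableT_comp (measurable_powR _)); apply: measurable_funX.
  exact: measurable_enorm.
by apply/funext => y; rewrite powR_inv1// exprn_ge0// enorm_ge0.
Qed.

Lemma measurable_fun_addl :
  measurable_fun [set: 'rV[R]_N] (fun y => phi (x + y)).
Proof.
rewrite (_ : (fun y => _) = phi \o (fun y => y + x)); last first.
  by apply/funext => y /=; rewrite addrC.
by apply: measurableT_comp => //; exact: measurable_rV_translation.
Qed.

(** The modulus at radius [s] is at most [K * s^alpha], so this is the dyadic estimate in dimension
    one with [rho] the identity. *)
Lemma dini_continuous_holder : dini_continuous_at phi x.
Proof.
rewrite /dini_continuous_at.
apply: (@integral_dyadic_lty _ (measurableTypeR R) R lebesgue_measure _
  (fun s => s) 1 1 K alpha) => //.
- move=> t /=; rewrite in_itv/= => /andP[t0 ->]; by rewrite ltW.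
- move=> s s0; rewrite mul1r expr1.
  apply: (@le_trans _ _ (lebesgue_measure `]0, s[%classic)).
    apply: le_measure; rewrite ?inE.
    + apply: measurableI => //.
      rewrite (_ : [set t | _] = `]-oo, s[%classic).
        exact: measurable_itv.
      by apply/seteqP; split => t /=; rewrite in_itv.
    + exact: measurable_itv.
    by move=> t [/=]; rewrite !in_itv/= => /andP[-> _] ->.
  by rewrite lebesgue_measure_itv/= lte_fin s0 sube0.
move=> s /=; rewrite in_itv/= => /andP[s0 s1].
have sV : (0 <= (s^-1)%:E)%E by rewrite lee_fin invr_ge0 ltW.
apply/andP; split.
  apply: mule_ge0 => //; apply: ereal_sup_ubound; exists x => /=.
    by rewrite subrr enorm0 ltW.
  by rewrite subrr normr0.
rewrite expr1 EFinM; apply: lee_wpmul2r => //.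
apply: ge_ereal_sup => _ [y /= ys <-]; rewrite lee_fin.
apply: le_trans (phiK _) _; rewrite ler_wpM2l//.
by rewrite ge0_ler_powR ?nnegrE ?enorm_ge0//; exact: ltW.
Qed.

Lemma lebesgue_rV_eball_lty (s : R) : 0 < s -> (mu (eball s) < +oo)%E.
Proof.
by move=> s0; apply: le_lt_trans (lebesgue_rV_eball _ _ _ s0) _; rewrite ltry.
Qed.

(** The weight is at most [1], and [phi] is bounded by [M] and vanishes off a ball of finite
    measure. *)
Lemma log_laplacian_domain_holder : log_laplacian_domain phi x.
Proof.
split => //; last exact: dini_continuous_holder.
apply: (@le_lt_trans _ _ (\int[mu]_z (M%:E * (\1_(eball r) z)%:E))%E).
  apply: ge0_le_integral_nonmeasurable => z _.
    by rewrite lee_fin mulr_ge0// invr_ge0 exprn_ge0// addr_ge0// enorm_ge0.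
  rewrite -EFinM lee_fin indicE.
  have [zr|zr] := pselect (eball r z); last first.
    by rewrite phir// normr0 mulr0 mulr_ge0.
  rewrite mem_set// mulr1 -[leRHS]mul1r ler_pM//.
    by rewrite invr_ge0 exprn_ge0// addr_ge0// enorm_ge0.
  by rewrite invf_le1 ?exprn_gt0 ?exprn_ege1 ?lerDl ?ltr_wpDr ?enorm_ge0.
rewrite ge0_integralZl//; last first.
  apply/measurable_EFinP/measurable_indic; exact: measurable_eball.
rewrite integral_indic//; last exact: measurable_eball.
rewrite setIT lte_mul_pinfty//; exact: lebesgue_rV_eball_lty.
Qed.

Let h y := (phi x - phi (x + y)) / enorm y ^+ N.

Let mh : measurable_fun [set: 'rV[R]_N] h.
Proof.
apply: measurable_div_enorm; apply: measurable_funB => //.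
exact: measurable_fun_addl.
Qed.

Lemma le_norm_increment y : `|h y| <= K * enorm y `^ alpha / enorm y ^+ N.
Proof.
rewrite normrM normfV normrX [`|enorm y|]ger0_norm ?enorm_ge0//.
rewrite ler_wpM2r ?invr_ge0 ?exprn_ge0 ?enorm_ge0// distrC.
by apply: le_trans (phiK _) _; rewrite addrAC subrr add0r.
Qed.

Lemma integrable_increment : mu.-integrable (eball 1) (EFin \o h).
Proof.
have m1 := @measurable_eball R N 1.
apply/integrableP; split; first exact/measurable_EFinP/measurable_funTS.
apply: (@integral_dyadic_lty _ _ _ _ _ (@enorm R N) N (2 ^+ N) K alpha) => //.
- apply: measurable_funTS. exact: measurable_enorm.
- by move=> t /= t1; rewrite enorm_ge0.
- move=> s s0; apply: le_trans (lebesgue_rV_eball _ _ _ s0).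
  apply: le_measure; rewrite ?inE; last by move=> t [].
  + by apply: measurableI => //; exact: measurable_eball.
  + exact: measurable_eball.
- by move=> t t1 /=; rewrite lee_fin normr_ge0/= lee_fin le_norm_increment.
Qed.

(** Dominated convergence with dominating function [|h|], applied along an arbitrary positive
    sequence [u] tending to [0]. *)
Lemma cvg_principal_value :
  (\int[mu]_(y in eball 1 `\` eball e) h y) @[e --> 0^'+] -->
  \int[mu]_(y in eball 1) h y.
Proof.
have m1 := @measurable_eball R N 1.
apply/cvg_at_rightP => u [u0 ucvg].
pose F k := h \_ (~` eball (u k)).
have mF k : measurable_fun (eball 1) (EFin \o F k).
  apply/measurable_EFinP/measurable_funTS.
  apply/(measurable_restrictT h (measurableC (measurable_eball R N (u k)))).
  exact: measurable_funTS.
have hF y : F ^~ y @ \oo --> h y.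
  (* The origin is cut out by every truncation, so convergence there rests on [h y = 0], which the
     Hoelder bound forces. Any other point is eventually kept. *)
  have [y0|] := eqVneq (enorm y) 0.
    have hy : h y = 0.
      have := le_norm_increment y.
      by rewrite y0 powR0 ?gt_eqF// mulr0 mul0r normr_le0 => /eqP.
    rewrite hy (_ : F ^~ y = fun=> 0); first exact: cvg_cst.
    by apply/funext => k; rewrite /F /patch hy; case: ifP.
  rewrite neq_lt ltNge enorm_ge0/= => y0.
  have uy : \forall k \near \oo, u k < enorm y by exact: (cvgr_lt 0).
  apply: cvg_near_cst; apply: filterS uy => k uk.
  by rewrite /F /patch mem_set//= /eball/=; apply/negP; rewrite -leNgt ltW.
have /= [_ _] := @dominated_convergence _ _ _ mu (eball 1) m1
  (fun k => EFin \o F k) (EFin \o h) (abse \o (EFin \o h)) mF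
  ltac:(exact/measurable_EFinP/measurable_funTS)
  ltac:(by apply: aeW => y _; apply: cvg_EFin; [exact: nearW|exact: hF])
  ltac:(exact: integrable_abse integrable_increment)
  ltac:(by apply: aeW => y k _ /=; rewrite lee_fin /F /patch;
    case: ifP => //; rewrite normr0).
rewrite -(fineK (integrable_fin_num m1 integrable_increment)) => /fine_cvg.
apply: cvg_trans; apply: near_eq_cvg; apply: nearW => k /=.
rewrite setDE Rintegral_mkcondr.
by [].
Qed.

Lemma log_laplacian_holder : log_laplacian phi x =
  c_ N * \int[mu]_(y in eball 1) h y
  - c_ N * \int[mu]_(y in ~` eball 1) (phi (x + y) / enorm y ^+ N)
  + rho_ N * phi x.
Proof.
by rewrite /log_laplacian (cvg_lim (@Rhausdorff R) cvg_principal_value).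
Qed.

(** Off the unit ball the kernel is at most [1], and [phi (x + y)] is bounded by [M] and vanishes
    unless [y] lies in a translated ball, whose measure is finite by translation invariance. *)
Lemma integrable_tail :
  mu.-integrable (~` eball 1) (fun y => (phi (x + y) / enorm y ^+ N)%:E).
Proof.
have m1 := @measurable_eball R N 1.
have mt : measurable (eball r : set 'rV[R]_N) by exact: measurable_eball.
pose A : set 'rV[R]_N := (fun y => y + x) @^-1` eball r.
have mA : measurable A.
  by rewrite -[X in measurable X]setTI; exact: measurable_rV_translation.
apply/integrableP; split.
  apply/measurable_EFinP/measurable_funTS; apply: measurable_div_enorm.
  exact: measurable_fun_addl.
apply: (@le_lt_trans _ _ (\int[mu]_(y in ~` eball 1) (M%:E * (\1_A y)%:E))%E).
  apply: ge0_le_integral_nonmeasurable => y /negP; rewrite -leNgt => y1.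
    by rewrite abse_ge0.
  rewrite /= -EFinM lee_fin indicE.
  have [yA|yA] := pselect (A y); last first.
    by rewrite phir ?mul0r ?normr0 ?mulr_ge0// addrC.
  rewrite mem_set// mulr1 normrM -[leRHS]mulr1 ler_pM//.
  rewrite normfV normrX [`|enorm y|]ger0_norm ?enorm_ge0//.
  by rewrite invf_le1 ?exprn_gt0 ?exprn_ege1// (lt_le_trans _ y1).
rewrite ge0_integralZl//; last 2 first.
- exact: measurableC.
- exact/measurable_EFinP/measurable_indic.
rewrite integral_indic//; last exact: measurableC.
rewrite lte_mul_pinfty//; apply: (@le_lt_trans _ _ (mu A)).
  apply: le_measure; rewrite ?inE//.
  by apply: measurableI => //; exact: measurableC.
by rewrite /A lebesgue_rV_translation// lebesgue_rV_eball_lty.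
Qed.

End log_laplacian_holder.

(** * Comparison of the two extensions *)

Lemma log_laplacian_ext0 (R : realType) (N : nat) (U : set 'rV[R]_N)
    (alpha : R) (f : 'rV[R]_N -> R) (x : 'rV[R]_N) :
  open U -> bounded_set U -> 0 < alpha -> holder alpha U f -> U x ->
  let phi := ext0 U f in
  [/\ log_laplacian_domain phi x,
      (lebesgue_rV N).-integrable (eball 1)
        (fun y => ((phi x - phi (x + y)) / enorm y ^+ N)%:E),
      (lebesgue_rV N).-integrable (~` eball 1)
        (fun y => (phi (x + y) / enorm y ^+ N)%:E) &
      log_laplacian phi x =
      c_ N * \int[lebesgue_rV N]_(y in eball 1)
        ((phi x - phi (x + y)) / enorm y ^+ N)
      - c_ N * \int[lebesgue_rV N]_(y in ~` eball 1)
        (phi (x + y) / enorm y ^+ N)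
      + rho_ N * phi x].
Proof.
move=> oU bU alpha0 hf Ux phi.
have mphi : measurable_fun [set: 'rV[R]_N] phi by exact: measurable_ext0 hf.
have [K K0 fK] := ext0_holder_at _ _ _ _ _ _ alpha0 oU hf Ux.
have [M M0 fM] := bounded_ext0 _ _ _ _ _ (ltW alpha0) bU hf.
have [r r0 Ur] := bounded_set_enorm _ _ _ bU.
have phir y : ~ eball r y -> phi y = 0.
  by move=> yr; rewrite /phi /ext0 patchN// notin_setE => /Ur.
split.
- exact: (log_laplacian_domain_holder _ _ _ _ alpha K M r).
- exact: (integrable_increment _ _ _ _ alpha K).
- exact: (integrable_tail _ _ _ _ M r).
- exact: (log_laplacian_holder _ _ _ _ alpha K).
Qed.

Lemma c_ge0 (R : realType) (N : nat) : 0 <= c_ N :> R.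
Proof.
rewrite /c_ divr_ge0 ?powR_ge0// /Gamma Rintegral_ge0// => t _.
by rewrite mulr_ge0 ?powR_ge0 ?expR_ge0.
Qed.

Theorem lemma1p5 (R : realType) (N : nat) (Omega Omega' : set 'rV[R]_N)
    (alpha : R) (f : 'rV[R]_N -> R) :
  (2 <= N)%N ->
  open Omega -> bounded_set Omega ->
  open Omega' -> bounded_set Omega' ->
  Omega' `<=` Omega ->
  0 < alpha -> holder alpha (closure Omega) f ->
  (forall x, Omega' x ->
    [/\ log_laplacian_domain (ext0 Omega' f) x,
        log_laplacian_domain (ext0 Omega f) x &
        log_laplacian (ext0 Omega' f) x - log_laplacian (ext0 Omega f) x =
        c_ N * \int[lebesgue_rV N]_(y in Omega `\` Omega')
                 (f y / enorm (x - y) ^+ N)]) /\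
  ((forall x, Omega x -> 0 <= f x) ->
   (forall x, Omega x -> 0 <= log_laplacian (ext0 Omega f) x) ->
   forall x, Omega' x -> 0 <= log_laplacian (ext0 Omega' f) x).
Proof.
move=> _ oO bO oO' bO' O'O alpha0 hf.
have hO : holder alpha Omega f by apply: holder_sub hf; exact: subset_closure.
have hO' : holder alpha Omega' f by exact: holder_sub hO.
set mu := lebesgue_rV N.
have main x : Omega' x ->
    [/\ log_laplacian_domain (ext0 Omega' f) x,
        log_laplacian_domain (ext0 Omega f) x &
        log_laplacian (ext0 Omega' f) x - log_laplacian (ext0 Omega f) x =
        c_ N * \int[mu]_(y in Omega `\` Omega') (f y / enorm (x - y) ^+ N)].
  move=> O'x.
  have [dO' iO' tO' ->] :=
    log_laplacian_ext0 _ _ _ _ _ _ oO' bO' alpha0 hO' O'x.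
  have [dO iO tO ->] :=
    log_laplacian_ext0 _ _ _ _ _ _ oO bO alpha0 hO (O'O _ O'x).
  split => //.
  have m1 := measurable_eball R N 1.
  have mC1 := measurableC m1.
  (* [g] is [f] on the part of [Omega] outside [Omega'] and zero elsewhere. Since [g x = 0], the
     difference of the increments in the unit ball is [g (x + y)], the same numerator as in the
     tail. *)
  pose g := ext0 Omega f \- ext0 Omega' f.
  pose G y := g (x + y) / enorm y ^+ N.
  have gx : ext0 Omega f x = ext0 Omega' f x.
    by rewrite /ext0 /patch !mem_set//; exact: O'O.
  have iG1 : mu.-integrable (eball 1) (EFin \o G).
    apply: eq_integrable (integrableB m1 iO' iO) => // y _ /=.
    by rewrite -EFinB -mulrBl gx /G /g /=; congr (_ / _)%:E; lra.
  have iGC : mu.-integrable (~` eball 1) (EFin \o G).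
    apply: eq_integrable (integrableB mC1 tO tO') => // y _ /=.
    by rewrite -EFinB -mulrBl.
  have mG : measurable_fun setT G.
    apply: measurable_div_enorm; apply: measurable_fun_addl.
    by apply: measurable_funB; apply: (measurable_ext0 _ _ alpha).
  have iG : mu.-integrable setT (EFin \o G).
    apply/integrableP; split; first exact/measurable_EFinP.
    rewrite -(setUv (eball 1)) ge0_integral_setU//; last 2 first.
    - by rewrite setUv; apply: measurableT_comp => //; exact/measurable_EFinP.
    - by apply/disj_setPS => y [].
    rewrite lte_add_pinfty//; first by case/integrableP : iG1.
    by case/integrableP : iGC.
  have GE : \int[mu]_y G y =
      \int[mu]_(y in Omega `\` Omega') (f y / enorm (x - y) ^+ N).
    (* [G] translated by [x]: it is the integrand of the claim, extended by zero from the set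
       difference. *)
    pose G' y := g y / enorm (y - x) ^+ N.
    rewrite [RHS]Rintegral_mkcond.
    rewrite (_ : _ \_ _ = G'); last first.
      apply/funext => y; rewrite /G' /g /= /ext0 /patch in_setD.
      have [yO|yO] := boolP (y \in Omega) => /=.
        have [yO'|yO'] := boolP (y \in Omega') => /=.
          by rewrite subrr mul0r.
        by rewrite subr0 -enormN opprB.
      rewrite ifF ?subrr ?mul0r//; apply: contraNF yO => /set_mem /O'O.
      exact: mem_set.
    rewrite -(@Rintegral_translation R N x G').
    - by apply: eq_Rintegral => y _; rewrite /G /G' addrK addrC.
    - rewrite (_ : G' = G \o (fun y => y + - x)); last first.
        by apply/funext => y; rewrite /G' /G /= [x + _]addrC subrK.
      by apply: measurableT_comp => //; exact: measurable_rV_translation.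
    - apply: eq_integrable iG => // y _ /=.
      by rewrite /G /G' addrK addrC.
  rewrite -GE -(setUv (eball 1)) Rintegral_setU//; last 2 first.
  - by rewrite setUv.
  - by apply/disj_setPS => y [].
  have -> : \int[mu]_(y in eball 1) G y =
    \int[mu]_(y in eball 1)
      ((ext0 Omega' f x - ext0 Omega' f (x + y)) / enorm y ^+ N)
    - \int[mu]_(y in eball 1)
      ((ext0 Omega f x - ext0 Omega f (x + y)) / enorm y ^+ N).
    rewrite -RintegralB//; apply: eq_Rintegral => y _.
    by rewrite -mulrBl gx /G /g /=; congr (_ / _); lra.
  have -> : \int[mu]_(y in ~` eball 1) G y =
    \int[mu]_(y in ~` eball 1) (ext0 Omega f (x + y) / enorm y ^+ N)
    - \int[mu]_(y in ~` eball 1) (ext0 Omega' f (x + y) / enorm y ^+ N).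
    rewrite -RintegralB//; apply: eq_Rintegral => y _.
    by rewrite -mulrBl.
  (* Both extensions agree at [x], so the [rho_] terms cancel. *)
  by rewrite gx; ring.
split=> // f0 L0 x O'x.
(* The identity writes the Laplacian for [Omega'] as the one for [Omega] plus [c_ N] times the
   integral of a nonnegative function. *)
have [_ _ /eqP] := main x O'x; rewrite subr_eq => /eqP ->.
rewrite addr_ge0 ?L0//; last exact: O'O.
rewrite mulr_ge0 ?c_ge0// Rintegral_ge0// => y [Oy _].
by rewrite divr_ge0 ?f0// exprn_ge0// enorm_ge0.
Qed.
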